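(* Every $12$-avoiding-representable graph is complete and every $21$-avoiding-representable graph is edgeless; that is, if a graph $G$ is $p$-representable, then $G$ is complete if $p=12$, and $G$ is edgeless if $p=21$. Moreover, if $G$ is $p$-representable with $p=11$, then $G$ is a permutation graph.
   Context: All graphs are finite, simple and undirected. Let $[n]=\{1,\ldots,n\}$. For a word $w$ over positive integers, $\mathrm{red}(w)$ is the word obtained from $w$ by replacing each occurrence of the $i$th smallest letter with $i$. For a word (pattern) $p=p_1\cdots p_k$ with $\mathrm{red}(p)=p$, a word $w=w_1\cdots w_\ell$ contains $p$ if there are indices $i_1<\cdots<i_k$ with $\mathrm{red}(w_{i_1}\cdots w_{i_k})=p$; otherwise $w$ avoids $p$ (is $p$-avoiding). A labeled graph with vertex set $[n]$ is $12$-represented by a word $w$ over $[n]$ containing at least one copy of each letter of $[n]$ if for all $i<j$ in $[n]$: $i$ and $j$ are adjacent if and only if every occurrence of $j$ precedes every occurrence of $i$ in $w$. For a pattern $p$, a graph on $n$ vertices is called $p$-representable (equivalently, ''$p$-avoiding-representable'') if its vertices can be labeled bijectively by $[n]$ so that the resulting labeled graph is $12$-represented by some $p$-avoiding word. (In particular ''$12$-representable'' in the sense of $p=12$ here means $12$-represented by a $12$-avoiding word.) The permutation graph of a permutation $\pi$ of $[n]$ (written as a word) is the graph on $[n]$ in which $i<j$ are adjacent if and only if $j$ occurs before $i$ in $\pi$; a graph is a permutation graph if it is isomorphic to the permutation graph of some permutation. *)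

(* Defs.v *)
From mathcomp Require Import all_boot all_fingroup.

Set Implicit Arguments.
Unset Strict Implicit.
Unset Printing Implicit Defensive.

(* Words over the positive integers are sequences of naturals. *)

Definition red (w : seq nat) : seq nat :=
  [seq (index x (sort leq (undup w))).+1 | x <- w].

Definition contains (p w : seq nat) : Prop :=
  exists2 s : seq nat, subseq s w & red s = p.

Definition avoids (p w : seq nat) : Prop := ~ contains p w.

Record sgraph := SGraph {
  vertex :> finType;
  adj : rel vertex;
  adj_sym : symmetric adj;
  adj_irrefl : irreflexive adj
}.

Definition complete (G : sgraph) : Prop := forall x y : G, x != y -> adj x y.

Definition edgeless (G : sgraph) : Prop := forall x y : G, ~~ adj x y.

Definition isomorphic (G H : sgraph) : Prop :=
  exists2 f : G -> H, bijective f & {mono f : x y / adj x y}.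

(* The vertex set {1, ..., n} is encoded by 'I_n, whose element i (with value
   in {0, ..., n-1}) carries the label i.+1; the letters of words and patterns
   are the labels themselves. *)
Definition label n (i : 'I_n) : nat := i.+1.

Definition all_precede (w : seq nat) (y x : nat) : Prop :=
  forall a b : nat, a < size w -> b < size w ->
    nth 0 w a = y -> nth 0 w b = x -> a < b.

(* e is the adjacency relation of a labeled graph on {1, ..., n}. *)
Definition represents12 n (e : rel 'I_n) (w : seq nat) : Prop :=
  (forall x : nat, (x \in w) = (1 <= x <= n)) /\
  (forall i j : 'I_n, i < j -> (e i j <-> all_precede w (label j) (label i))).

Definition representable (p : seq nat) (G : sgraph) : Prop :=
  exists2 f : 'I_#|G| -> G, bijective f &
    exists2 w : seq nat, avoids p w &
      represents12 [rel i j | adj (f i) (f j)] w.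

Definition perm_word n (s : 'S_n) : seq nat :=
  [seq label (s i) | i <- enum 'I_n].

Definition perm_before n (s : 'S_n) (j i : 'I_n) : bool :=
  index (label j) (perm_word s) < index (label i) (perm_word s).

Definition perm_adj n (s : 'S_n) : rel 'I_n :=
  [rel i j : 'I_n | ((i < j) && perm_before s j i)
                 || ((j < i) && perm_before s i j)].

Lemma perm_adj_sym n (s : 'S_n) : symmetric (perm_adj s).
Proof. by move=> i j; rewrite /perm_adj /= orbC. Qed.

Lemma perm_adj_irrefl n (s : 'S_n) : irreflexive (perm_adj s).
Proof. by move=> i; rewrite /perm_adj /= ltnn. Qed.

Definition perm_graph n (s : 'S_n) : sgraph :=
  SGraph (@perm_adj_sym n s) (@perm_adj_irrefl n s).

Definition permutation_graph (G : sgraph) : Prop :=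
  exists n (s : 'S_n), isomorphic G (perm_graph s).

(* Main.v *)
Require Import Defs.
From mathcomp Require Import all_boot all_fingroup.

Set Implicit Arguments.
Unset Strict Implicit.
Unset Printing Implicit Defensive.

(** For a pattern of length two, avoidance is a condition on pairs of
    positions: a word has no copy of [12] when, among distinct letters, the
    larger always comes first, no copy of [21] when the smaller always comes
    first, and no copy of [11] when its letters are distinct
    ([contains_pair]).

    In a labeled graph [12]-represented by a word, the vertices [i < j] are
    adjacent exactly when all the [j] come before all the [i].  If the word
    avoids [12], this holds for every pair, so the graph is complete.  If it
    avoids [21], it holds for no pair, since both letters do occur in the word.
    If it avoids [11], the word is a permutation of the labels
    ([perm_word_exists]), and for a word without repetition the condition
    only compares the unique positions of [j] and [i] ([all_precede_uniq]):
    this is the definition of the permutation graph of that word. *)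

Lemma subseq_nth_pair (w : seq nat) a b :
  a < b -> b < size w -> subseq [:: nth 0 w a; nth 0 w b] w.
Proof.
move=> ab bw; rewrite -[w in subseq _ w](cat_take_drop b w).
apply: (@cat_subseq _ [:: _] [:: _]); rewrite sub1seq.
  by rewrite -(nth_take 0 ab) mem_nth // size_take bw.
by rewrite (drop_nth 0 bw) mem_head.
Qed.

Lemma red_lt x y : x < y -> red [:: x; y] = [:: 1; 2].
Proof.
move=> xy; rewrite /red /= inE (ltn_eqF xy).
have -> : sort leq [:: x; y] = [:: x; y].
  by apply: (sorted_sort leq_trans); rewrite /= (ltnW xy).
by rewrite /= !eqxx (ltn_eqF xy).
Qed.

Lemma red_gt x y : y < x -> red [:: x; y] = [:: 2; 1].
Proof.
move=> yx; rewrite /red /= inE (gtn_eqF yx).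
have -> : sort leq [:: x; y] = [:: y; x].
  apply: (sorted_eq leq_trans anti_leq); first exact: sort_sorted leq_total _.
    by rewrite /= (ltnW yx).
  by rewrite perm_sort (perm_catC [:: x] [:: y]).
by rewrite /= !eqxx (ltn_eqF yx).
Qed.

Lemma red_eq x : red [:: x; x] = [:: 1; 1].
Proof. by rewrite /red /= inE eqxx /= eqxx. Qed.

Lemma contains_pair p (w : seq nat) a b :
  a < b -> b < size w -> red [:: nth 0 w a; nth 0 w b] = p -> contains p w.
Proof.
by move=> ab bw <-; exists [:: nth 0 w a; nth 0 w b] => //; apply: subseq_nth_pair.
Qed.

Lemma avoids11_uniq w : avoids [:: 1; 1] w -> uniq w.
Proof.
move=> av; apply/(uniqP 0) => a b; rewrite !inE => aw bw eq_ab.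
case: (ltngtP a b) => // lt_ab; case: av.
  by apply: (contains_pair lt_ab) => //; rewrite eq_ab red_eq.
by apply: (contains_pair lt_ab) => //; rewrite eq_ab red_eq.
Qed.

Lemma avoids12_all_precede w x y :
  avoids [:: 1; 2] w -> x < y -> all_precede w y x.
Proof.
move=> av xy a b aw bw ya xb; case: (ltngtP a b) => // [ba | eq_ab].
  by case: av; apply: (contains_pair ba) => //; rewrite xb ya red_lt.
by move: xy; rewrite -xb -ya eq_ab ltnn.
Qed.

(** The membership hypotheses matter: a letter that does not occur would
    precede every other letter vacuously. *)
Lemma avoids21_all_precede w x y :
    avoids [:: 2; 1] w -> x \in w -> y \in w -> x < y ->
  ~ all_precede w y x.
Proof.
move=> av xw yw xy prec; case: av.
have lt_ba : index y w < index x w by apply: prec; rewrite ?index_mem ?nth_index.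
by apply: (contains_pair lt_ba); rewrite ?index_mem ?nth_index ?red_gt.
Qed.

Lemma all_precede_uniq w x y :
    uniq w -> x \in w -> y \in w ->
  all_precede w y x <-> index y w < index x w.
Proof.
move=> uw xw yw; split=> [prec | lt_yx a b aw bw ya xb].
  by apply: prec; rewrite ?index_mem ?nth_index.
by move: lt_yx; rewrite -ya -xb !index_uniq.
Qed.

(** A word without repetition on the letters [1], ..., [n] has length [n], so
    its letters, read by position, form an injective self-map of ['I_n]. *)
Lemma perm_word_exists n w :
    uniq w -> (forall x, (x \in w) = (1 <= x <= n)) ->
  exists s : 'S_n, perm_word s = w.
Proof.
move=> uw memw.
have szw : size w = n.
  rewrite -(size_iota 1 n); apply: perm_size; apply: uniq_perm => //.
    exact: iota_uniq.
  by move=> x; rewrite memw mem_iota add1n ltnS.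
have wi (i : 'I_n) : 1 <= nth 0 w i <= n by rewrite -memw mem_nth ?szw.
have pred_wi (i : 'I_n) : (nth 0 w i).-1 < n.
  by case/andP: (wi i) => w_gt0; rewrite prednK.
pose g i := Ordinal (pred_wi i).
have label_g i : label (g i) = nth 0 w i.
  by case/andP: (wi i) => w_gt0 _; rewrite /label /= prednK.
have g_inj : injective g.
  move=> i j /(congr1 (@label n)); rewrite !label_g => /eqP.
  by rewrite nth_uniq ?szw // => /eqP/val_inj.
exists (perm g_inj).
rewrite /perm_word (eq_map (g := nth 0 w \o val)); last first.
  by move=> i; rewrite permE label_g.
by rewrite map_comp val_enum_ord -szw; apply: mkseq_nth.
Qed.

(** Symmetry of adjacency reduces a property of all pairs of vertices to pairs
    whose labels are increasing, the only ones that a representing word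
    constrains. *)
Lemma labeled_pair_ind (G : sgraph) n (f : 'I_n -> G) (P : G -> G -> Prop) :
    bijective f -> (forall x y, P x y -> P y x) ->
    (forall i j : 'I_n, i < j -> P (f i) (f j)) ->
  forall x y, x != y -> P x y.
Proof.
case=> g fK gK symP ltP x y; rewrite -(gK x) -(gK y) (can_eq fK).
by rewrite -val_eqE neq_ltn => /orP[/ltP // | /ltP/symP].
Qed.

Lemma represents12_label_mem n (e : rel 'I_n) w (i : 'I_n) :
  represents12 e w -> label i \in w.
Proof. by case=> memw _; rewrite memw /label /= ltn_ord. Qed.

Lemma representable12_complete (G : sgraph) :
  representable [:: 1; 2] G -> complete G.
Proof.
case=> f bij_f [w av [memw adjw]].
apply: (labeled_pair_ind bij_f) => [x y | i j ij]; first by rewrite adj_sym.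
by apply/(adjw i j ij)/avoids12_all_precede.
Qed.

Lemma representable21_edgeless (G : sgraph) :
  representable [:: 2; 1] G -> edgeless G.
Proof.
case=> f bij_f [w av rep] x y.
have [-> | ] := eqVneq x y; first by rewrite adj_irrefl.
move: x y; apply: (labeled_pair_ind bij_f) => [x y | i j ij].
  by rewrite adj_sym.
apply/negP => /(proj2 rep i j ij).
by apply: (avoids21_all_precede av); rewrite ?(represents12_label_mem _ rep).
Qed.

Lemma representable11_permutation_graph (G : sgraph) :
  representable [:: 1; 1] G -> permutation_graph G.
Proof.
case=> f bij_f [w av rep]; have [memw adjw] := rep.
have uw := avoids11_uniq av.
have [s s_w] := perm_word_exists uw memw.
have adj_lt (i j : 'I_#|G|) : i < j -> adj (f i) (f j) = perm_before s j i.
  move=> ij; rewrite /perm_before s_w; have lab k := represents12_label_mem k rep.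
  have precP := all_precede_uniq uw (lab i) (lab j).
  by apply/idP/idP => [/(adjw i j ij)/precP // | /precP/(adjw i j ij)].
have adj_f (i j : 'I_#|G|) : perm_adj s i j = adj (f i) (f j).
  rewrite /perm_adj /=; case: (ltngtP i j) => [ij | ji | /val_inj ->].
  - by rewrite orbF adj_lt.
  - by rewrite adj_sym adj_lt.
  - by rewrite adj_irrefl.
case: bij_f => g fK gK; exists #|G|, s; exists g; first by exists f.
by move=> x y; rewrite /= adj_f !gK.
Qed.

Theorem proposition9 (G : sgraph) :
  [/\ representable [:: 1; 2] G -> complete G,
      representable [:: 2; 1] G -> edgeless G
    & representable [:: 1; 1] G -> permutation_graph G].
Proof.
split.
- exact: representable12_complete.
- exact: representable21_edgeless.
- exact: representable11_permutation_graph.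
Qed.
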